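(* Let $n\ge 3$, let $c_{ij}$ ($1\le i,j\le n$) be real costs with $c_{ii}=0$ for all $i$ and $c_{ij}\ge 0$ for all $i\ne j$, let $\varepsilon>0$, and let $c_{\max}:=\max_{1\le i,j\le n}c_{ij}+\varepsilon$. For $x\in[0,1]^{n\times n}$ define $$\rho_i(x):=\sum_{j=1}^n x_{ij}-1,\qquad \kappa_j(x):=\sum_{i=1}^n x_{ij}-1,$$ $$V_{\mathrm{deg}}(x):=\sum_{i=1}^n\rho_i(x)^2+\sum_{j=1}^n\kappa_j(x)^2-2\sum_{i=1}^n\sum_{j=1}^n x_{ij}^2+2\sum_{i=1}^n\sum_{j=1}^n x_{ij},$$ $$\hat f_{\mathrm{deg}}(x):=\sum_{i=1}^n\sum_{j=1}^n c_{ij}x_{ij}+\varepsilon\sum_{i=1}^n\sum_{j=1}^n x_{ij}+\gamma V_{\mathrm{deg}}(x).$$ Assume $\gamma>c_{\max}$. Then every local minimizer $x^\star$ of $\hat f_{\mathrm{deg}}$ over $[0,1]^{n\times n}$ satisfies $$\sum_{j=1}^n x^\star_{ij}=1\ \ \forall i,\qquad \sum_{i=1}^n x^\star_{ij}=1\ \ \forall j,$$ and hence is feasible for the assignment problem $$\min_x\ \sum_{i,j}c_{ij}x_{ij}\quad\text{s.t.}\quad \sum_{j}x_{ij}=1\ \forall i,\quad \sum_i x_{ij}=1\ \forall j,\quad x_{ij}\in\{0,1\}$$ (in particular $x^\star\in\{0,1\}^{n\times n}$).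
   Context: A local minimizer over $[0,1]^{n\times n}$ is a point of the box minimizing $\hat f_{\mathrm{deg}}$ among all points of the box in some neighborhood of it. *)

(* Defs.v *)
From HB Require Import structures.
From mathcomp Require Import all_boot all_order all_algebra.
From mathcomp Require Import boolp classical_sets reals topology normedtype.

Set Implicit Arguments.
Unset Strict Implicit.
Unset Printing Implicit Defensive.

Import Order.TTheory GRing.Theory Num.Theory.
Import numFieldNormedType.Exports.

Local Open Scope classical_set_scope.
Local Open Scope ring_scope.

Definition local_minimizer (R : realType) (T : topologicalType)
    (A : set T) (f : T -> R) (x : T) : Prop :=
  A x /\ \forall y \near x, A y -> f x <= f y.

Definition unit_box (R : realType) (n : nat) : set 'M[R]_n :=
  [set x | forall i j, 0 <= x i j <= 1].

Definition rho (R : realType) (n : nat) (x : 'M[R]_n) (i : 'I_n) : R :=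
  \sum_(j < n) x i j - 1.

Definition kappa (R : realType) (n : nat) (x : 'M[R]_n) (j : 'I_n) : R :=
  \sum_(i < n) x i j - 1.

Definition V_deg (R : realType) (n : nat) (x : 'M[R]_n) : R :=
  \sum_(i < n) rho x i ^+ 2 + \sum_(j < n) kappa x j ^+ 2
  - 2 * (\sum_(i < n) \sum_(j < n) x i j ^+ 2)
  + 2 * (\sum_(i < n) \sum_(j < n) x i j).

Definition assignment_cost (R : realType) (n : nat) (c x : 'M[R]_n) : R :=
  \sum_(i < n) \sum_(j < n) c i j * x i j.

Definition f_deg (R : realType) (n : nat) (c : 'M[R]_n) (eps gamma : R)
    (x : 'M[R]_n) : R :=
  assignment_cost c x + eps * (\sum_(i < n) \sum_(j < n) x i j)
  + gamma * V_deg x.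

(* The default value 0 of the iterated maximum does not change it when c has a
   nonnegative entry, e.g. when n > 0 and the diagonal of c vanishes. *)
Definition c_max (R : realType) (n : nat) (c : 'M[R]_n) (eps : R) : R :=
  \big[Num.max/0]_(i < n) \big[Num.max/0]_(j < n) c i j + eps.

Definition assignment_feasible (R : realType) (n : nat) : set 'M[R]_n :=
  [set x | [/\ forall i, \sum_(j < n) x i j = 1,
               forall j, \sum_(i < n) x i j = 1
             & forall i j, x i j = 0 \/ x i j = 1]].

(* Main.v *)
(**
  Along a single entry (i, j) the squares of [rho] and [kappa] cancel
  [- 2 x_ij ^ 2], so [f_deg] is affine there, with slope
  [c_ij + eps + 2 gamma (S - 1)], where [S] is the sum of the other entries
  of row [i] and column [j].  As [0 < c_ij + eps < gamma], the slope is positive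
  if one of these entries is 1, and negative if all of them vanish.  Two
  fractional entries in the same line both have slope 0, and moving them in
  opposite directions decreases [f_deg] to second order.  Hence a local
  minimizer is a 0/1 matrix whose ones form a maximal matching of the complete
  bipartite graph, which is perfect.
*)
Require Import Defs.
From HB Require Import structures.
From mathcomp Require Import all_boot all_order all_algebra.
From mathcomp Require Import boolp classical_sets reals topology normedtype.
From mathcomp Require Import ring lra.

Import Order.TTheory GRing.Theory Num.Theory.
Import numFieldNormedType.Exports.

Local Open Scope classical_set_scope.
Local Open Scope ring_scope.

Lemma big_update (V : zmodType) (I : finType) (i : I) (F G : I -> V) :
  (forall k, k != i -> G k = F k) ->
  \sum_k G k = \sum_k F k + (G i - F i).
Proof.
move=> GF; rewrite (bigD1 i) //= [in RHS](bigD1 i) //= (eq_bigr F GF).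
by rewrite [RHS]addrC addrA subrK.
Qed.

(** * Single-entry perturbations and the slope of [f_deg] *)

Section Landscape.
Context {R : realType} {n : nat}.
Implicit Types (c x : 'M[R]_n) (i j k l : 'I_n) (s : R).

Definition shift_entry x i j s : 'M[R]_n := x + s *: delta_mx i j.

Lemma shift_entryE x i j s k l :
  shift_entry x i j s k l = x k l + s * ((k == i) && (l == j))%:R.
Proof. by rewrite !mxE. Qed.

Lemma rho_shift x i j s k :
  rho (shift_entry x i j s) k = rho x k + s * (k == i)%:R.
Proof.
rewrite /rho (big_update _ _ j (fun l => x k l)) => [|l /negPf lj].
  by rewrite shift_entryE eqxx andbT; ring.
by rewrite shift_entryE lj andbF mulr0 addr0.
Qed.

Lemma kappa_shift x i j s l :
  kappa (shift_entry x i j s) l = kappa x l + s * (l == j)%:R.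
Proof.
rewrite /kappa (big_update _ _ i (fun k => x k l)) => [|k /negPf ki].
  by rewrite shift_entryE eqxx /=; ring.
by rewrite shift_entryE ki mulr0 addr0.
Qed.

(** Generic in [F] so that the linear cost, the total and the sum of squares are all instances. *)
Lemma sum_shift (F : 'I_n -> 'I_n -> R -> R) x i j s :
  \sum_k \sum_l F k l (shift_entry x i j s k l) =
  \sum_k \sum_l F k l (x k l) + (F i j (x i j + s) - F i j (x i j)).
Proof.
rewrite (big_update _ _ i (fun k => \sum_l F k l (x k l))) => [|k /negPf ki].
  congr (_ + _); apply/eqP; rewrite subr_eq addrC; apply/eqP.
  rewrite (big_update _ _ j (fun l => F i l (x i l))) => [|l /negPf lj].
    by rewrite shift_entryE !eqxx mulr1.
  by rewrite shift_entryE lj andbF mulr0 addr0.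
by apply: eq_bigr => l _; rewrite shift_entryE ki mulr0 addr0.
Qed.

(** The partial derivative of [f_deg] in entry [(i, j)]. The term [- 2 * x i j] removes the copies
    of the entry inside [rho] and [kappa], so the value is independent of [x i j]. *)
Definition slope c (eps gamma : R) x i j : R :=
  c i j + eps + 2 * gamma * (rho x i + kappa x j - 2 * x i j + 1).

Lemma slopeE c eps gamma x i j :
  slope c eps gamma x i j = c i j + eps +
    2 * gamma * (\sum_(l | l != j) x i l + \sum_(k | k != i) x k j - 1).
Proof.
rewrite /slope /rho /kappa (bigD1 j) //= [X in _ + (X - 1) - _](bigD1 i) //=.
ring.
Qed.

Lemma f_deg_shift c eps gamma x i j s :
  f_deg c eps gamma (shift_entry x i j s) =
  f_deg c eps gamma x + s * slope c eps gamma x i j.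
Proof.
rewrite /f_deg /V_deg /assignment_cost.
rewrite (sum_shift (fun k l t => c k l * t)) (sum_shift (fun _ _ t => t)).
rewrite (sum_shift (fun _ _ t => t ^+ 2)).
have -> : \sum_k rho (shift_entry x i j s) k ^+ 2 =
    \sum_k rho x k ^+ 2 + ((rho x i + s) ^+ 2 - rho x i ^+ 2).
  rewrite (big_update _ _ i (fun k => rho x k ^+ 2)) => [|k /negPf ki].
    by rewrite rho_shift eqxx mulr1.
  by rewrite rho_shift ki mulr0 addr0.
have -> : \sum_l kappa (shift_entry x i j s) l ^+ 2 =
    \sum_l kappa x l ^+ 2 + ((kappa x j + s) ^+ 2 - kappa x j ^+ 2).
  rewrite (big_update _ _ j (fun l => kappa x l ^+ 2)) => [|l /negPf lj].
    by rewrite kappa_shift eqxx mulr1.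
  by rewrite kappa_shift lj mulr0 addr0.
rewrite /slope; ring.
Qed.

(** Exclusive or: the positions share a row or a column but do not coincide. *)
Definition collinear i j k l := (k == i) != (l == j).

(** Exactly one of [rho x k] and [kappa x l] moves, by [s], while [x k l] stays fixed. *)
Lemma slope_shift c eps gamma x i j s k l : collinear i j k l ->
  slope c eps gamma (shift_entry x i j s) k l =
  slope c eps gamma x k l + 2 * gamma * s.
Proof.
rewrite /slope rho_shift kappa_shift shift_entryE /collinear.
by case: (k == i); case: (l == j) => //= _; ring.
Qed.

Lemma local_minimizer_mxP (A : set 'M[R]_n) (f : 'M[R]_n -> R) x :
  local_minimizer A f x -> exists2 e, 0 < e &
  forall y, A y -> (forall i j, `|x i j - y i j| < e) -> f x <= f y.
Proof.
move=> [_ /nbhs_ballP [e e0 xe]]; exists e => // y Ay xy.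
by apply: xe.
Qed.

Lemma c_max_ge c eps i j : c i j + eps <= c_max c eps.
Proof.
rewrite lerD2r; apply: (le_trans (le_bigmax _ _ j)).
exact: (le_bigmax _ (fun i => \big[Num.max/0]_(j < n) c i j) i).
Qed.

(** * First- and second-order conditions at a local minimizer *)

Section LocalMinimizer.
Context (c : 'M[R]_n) (eps gamma : R) (x : 'M[R]_n).
Context (c_ge0 : forall i j, 0 <= c i j).
Context (eps_gt0 : 0 < eps).
Context (gamma_gt : c_max c eps < gamma).
Context (x_min : local_minimizer (@unit_box R n) (f_deg c eps gamma) x).

Let x_box i j : 0 <= x i j <= 1. Proof. by case: x_min. Qed.

Let slope_const_gt0 i j : 0 < c i j + eps.
Proof. by rewrite ltr_wpDl. Qed.

Let slope_const_lt i j : c i j + eps < gamma.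
Proof. exact: le_lt_trans (c_max_ge _ _ _ _) gamma_gt. Qed.

Let gamma_gt0 i j : 0 < gamma.
Proof. exact: lt_trans (slope_const_gt0 i j) (slope_const_lt i j). Qed.

Lemma slope_ge0 i j : x i j < 1 -> 0 <= slope c eps gamma x i j.
Proof.
move=> x1; have [e e0 min] := local_minimizer_mxP _ _ _ x_min.
have [s [s0 s1 se]] : exists s, [/\ 0 < s, s <= 1 - x i j & s < e].
  (* The first bound keeps the shifted point in the box, the second keeps it strictly within radius
     [e]. *)
  exists (Num.min (1 - x i j) (e / 2)).
  by rewrite lt_min ge_min gt_min lexx; split => //; lra.
suff : f_deg c eps gamma x <= f_deg c eps gamma (shift_entry x i j s).
  by rewrite f_deg_shift lerDl pmulr_rge0.
apply: min => k l; rewrite shift_entryE; have := x_box k l.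
all: case: eqP => [->|_]; case: eqP => [->|_] /=; rewrite ?ltr_norml; lra.
Qed.

Lemma slope_le0 i j : 0 < x i j -> slope c eps gamma x i j <= 0.
Proof.
move=> x0; have [e e0 min] := local_minimizer_mxP _ _ _ x_min.
have [s [s0 s1 se]] : exists s, [/\ 0 < s, s <= x i j & s < e].
  exists (Num.min (x i j) (e / 2)).
  by rewrite lt_min ge_min gt_min lexx; split => //; lra.
suff : f_deg c eps gamma x <= f_deg c eps gamma (shift_entry x i j (- s)).
  by rewrite f_deg_shift lerDl mulNr oppr_ge0 pmulr_rle0.
apply: min => k l; rewrite shift_entryE; have := x_box k l.
all: case: eqP => [->|_]; case: eqP => [->|_] /=; rewrite ?ltr_norml; lra.
Qed.

Lemma no_collinear_fractional i j k l : collinear i j k l ->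
  0 < x i j < 1 -> ~ 0 < x k l < 1.
Proof.
move=> col /andP[xij0 xij1] /andP[xkl0 xkl1].
have [e e0 min] := local_minimizer_mxP _ _ _ x_min.
have gij : slope c eps gamma x i j = 0.
  by apply: le_anti; rewrite slope_le0 ?slope_ge0.
have gkl : slope c eps gamma x k l = 0.
  by apply: le_anti; rewrite slope_le0 ?slope_ge0.
have [s [s0 s1 s2 se]] :
    exists s, [/\ 0 < s, s <= 1 - x i j, s <= x k l & s < e].
  exists (Num.min (1 - x i j) (Num.min (x k l) (e / 2))).
  by rewrite !lt_min !ge_min !gt_min !lexx orbT; split => //; lra.
pose y := shift_entry (shift_entry x i j s) k l (- s).
suff : f_deg c eps gamma x <= f_deg c eps gamma y.
  (* The first move costs nothing but raises the slope at [(k, l)] from 0 to [2 * gamma * s], so the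
     second move changes [f_deg] by [- 2 * gamma * s ^+ 2]. *)
  rewrite !f_deg_shift slope_shift // gij gkl mulr0 addr0 add0r lerDl leNgt.
  by rewrite mulNr oppr_lt0 !mulr_gt0 // (gamma_gt0 i j).
(* No entry receives both moves, so the bounds can be checked one entry at a time. *)
have ne : (i == k) && (j == l) = false.
  by apply/negP => /andP[/eqP ik /eqP jl]; move: col; rewrite /collinear ik jl !eqxx.
apply: min => a b; rewrite !shift_entryE; have := x_box a b.
all: have [/andP[/eqP-> /eqP->]|_] := boolP ((a == i) && (b == j));
  [rewrite ne | have [/andP[/eqP-> /eqP->]|_] := boolP ((a == k) && (b == l))].
all: rewrite /= ?ltr_norml; lra.
Qed.

(** * Collinear entries and integrality *)

Lemma sum_others_ge0 i j :
  0 <= \sum_(l | l != j) x i l /\ 0 <= \sum_(k | k != i) x k j.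
Proof.
by split; apply: sumr_ge0 => m _; [case/andP: (x_box i m) | case/andP: (x_box m j)].
Qed.

Lemma collinear_sum i j k l : collinear i j k l ->
  x k l <= \sum_(l | l != j) x i l + \sum_(k | k != i) x k j.
Proof.
have [r0 c0] := sum_others_ge0 i j; rewrite /collinear.
have [->|ki] := eqVneq k i; have [->|lj] := eqVneq l j => // _.
  apply: ler_wpDr => //; rewrite (bigD1 l) //= lerDl.
  by apply: sumr_ge0 => m _; have /andP[] := x_box i m.
rewrite addrC; apply: ler_wpDr => //; rewrite (bigD1 k) //= lerDl.
by apply: sumr_ge0 => m _; have /andP[] := x_box m j.
Qed.

(** The other entries of the two lines sum to at least 1, so the slope is at least
    [c i j + eps > 0]; a positive entry could then be lowered profitably. *)
Lemma collinear_one i j k l : collinear i j k l -> x k l = 1 -> x i j = 0.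
Proof.
move=> col xkl; apply/eqP; apply: contraT => xij.
have := collinear_sum _ _ _ _ col; rewrite xkl -subr_ge0 => S.
have : slope c eps gamma x i j <= 0.
  by apply: slope_le0; rewrite lt_neqAle eq_sym xij; have /andP[] := x_box i j.
rewrite slopeE leNgt ltr_wpDr // ?slope_const_gt0 //.
by rewrite mulr_ge0 // mulr_ge0 // ltW // (gamma_gt0 i j).
Qed.

(** Otherwise the slope would be [c i j + eps - 2 * gamma], negative by the bound on [gamma], and
    raising the entry would pay off. *)
Lemma collinear_pos i j : x i j < 1 -> exists k l, collinear i j k l /\ 0 < x k l.
Proof.
move=> xij; apply: contrapT => no; have := slope_ge0 _ _ xij.
have x0 k l : collinear i j k l -> x k l = 0.
  move=> col; apply/eqP; apply: contraT => xkl; case: no; exists k, l.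
  by split => //; rewrite lt_neqAle eq_sym xkl; have /andP[] := x_box k l.
rewrite slopeE !big1 => [|k /negPf ki|l /negPf lj].
- by have := slope_const_lt i j; have := gamma_gt0 i j; lra.
- by rewrite x0 // /collinear ki eqxx.
- by rewrite x0 // /collinear lj eqxx.
Qed.

(** A fractional entry has a positive collinear companion, which cannot be fractional too; so the
    companion is 1 and forces the entry to 0. *)
Lemma integral i j : x i j = 0 \/ x i j = 1.
Proof.
have /andP[x0 x1] := x_box i j.
have [/eqP ? | xn0] := boolP (x i j == 0); first by left.
have [/eqP ? | xn1] := boolP (x i j == 1); first by right.
have x_frac : 0 < x i j < 1 by rewrite !lt_neqAle eq_sym xn0 x0 xn1.
have /andP[_ /collinear_pos[k [l [col xkl]]]] := x_frac.
have := no_collinear_fractional _ _ _ _ col x_frac; rewrite xkl /= => xkl1.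
case/eqP: xn0; apply: collinear_one col _.
by apply: le_anti; rewrite [1 <= _]leNgt; have /andP[_ ->] := x_box k l; apply/negP.
Qed.

(** * Maximality and perfection of the matching formed by the ones *)

Lemma collinear_exists_one i j :
  x i j = 0 -> exists k l, collinear i j k l /\ x k l = 1.
Proof.
move=> xij; have [|k [l [col xkl]]] := collinear_pos i j; first by rewrite xij.
exists k, l; split => //; have [xkl0|//] := integral k l.
by rewrite xkl0 ltxx in xkl.
Qed.

(* If row [i] had no 1, each column would have one by maximality, giving an
   injection of the columns into the rows that avoids [i]. *)
Lemma row_has_one i : exists j, x i j = 1.
Proof.
apply: contrapT => no1.
have /fin_all_exists [p xp] : forall j, exists k, x k j = 1.
  move=> j; have [xij0|xij1] := integral i j; last by exists i.
  have [k [l [col xkl]]] := collinear_exists_one _ _ xij0.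
  move: col; rewrite /collinear; have [ki|_] := eqVneq k i.
    by case: no1; exists l; rewrite -ki.
  by have [lj _|] := eqVneq l j; first by exists k; rewrite -lj.
have p_inj : injective p.
  move=> j l pjl; apply/eqP; apply: contraT => /negPf jl.
  have : x (p j) j = 0.
    by apply: (collinear_one _ _ (p j) l); rewrite ?pjl // /collinear eqxx [l == _]eq_sym jl.
  by move/eqP; rewrite xp oner_eq0.
have [q _ pq] := injF_bij p_inj.
by case: no1; exists (q i); rewrite -[X in x X]pq.
Qed.

(** Choosing a 1 in each row maps rows injectively to columns, hence bijectively since both are
    indexed by ['I_n]. *)
Lemma column_has_one j : exists i, x i j = 1.
Proof.
have /fin_all_exists [p xp] := row_has_one.
have p_inj : injective p.
  move=> i k pik; apply/eqP; apply: contraT => /negPf ik.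
  have : x i (p i) = 0.
    by apply: (collinear_one _ _ k (p i)); rewrite ?pik // /collinear eqxx [k == _]eq_sym ik.
  by move/eqP; rewrite xp oner_eq0.
have [q _ pq] := injF_bij p_inj.
by exists (q j); rewrite -[X in x _ X]pq.
Qed.

Lemma row_sum_one i : \sum_j x i j = 1.
Proof.
have [j xij] := row_has_one i; rewrite (bigD1 j) //= big1 ?addr0 // => l /negPf lj.
by apply: collinear_one xij; rewrite /collinear eqxx [j == _]eq_sym lj.
Qed.

Lemma column_sum_one j : \sum_i x i j = 1.
Proof.
have [i xij] := column_has_one j; rewrite (bigD1 i) //= big1 ?addr0 // => k /negPf ki.
by apply: collinear_one xij; rewrite /collinear eqxx [i == _]eq_sym ki.
Qed.

End LocalMinimizer.
End Landscape.

Theorem theorem3p7 (R : realType) (n : nat) (c : 'M[R]_n) (eps gamma : R)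
    (n_ge3 : (3 <= n)%N)
    (c_diag : forall i, c i i = 0)
    (c_ge0 : forall i j, i != j -> 0 <= c i j)
    (eps_gt0 : 0 < eps)
    (gamma_gt : c_max c eps < gamma)
    (x : 'M[R]_n)
    (x_min : local_minimizer (@unit_box R n) (f_deg c eps gamma) x) :
  [/\ forall i, \sum_(j < n) x i j = 1,
      forall j, \sum_(i < n) x i j = 1
    & @assignment_feasible R n x].
Proof.
have c0 i j : 0 <= c i j by have [->|/c_ge0//] := eqVneq i j; rewrite c_diag.
have rows := row_sum_one _ _ _ _ c0 eps_gt0 gamma_gt x_min.
have cols := column_sum_one _ _ _ _ c0 eps_gt0 gamma_gt x_min.
split => //; split => //.
exact: integral c0 eps_gt0 gamma_gt x_min.
Qed.
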